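(* Let $X$ be an infinite set, let $G$ be a group with $\mathrm{FAlt}(X)\leqslant G\leqslant \mathrm{Sym}(X)$, and let $\rho\in N_{\mathrm{Sym}(X)}(G)$. If there is an $r\in\mathbb{N}$ such that $\eta_r(\rho)<\infty$, then $R(\phi_\rho)=\infty$.
   Context: $\mathbb{N}=\{1,2,\ldots\}$. For a set $X$, $\mathrm{Sym}(X)$ is the group of all permutations of $X$ (acting on the right) and $\mathrm{FAlt}(X)$ is the subgroup of even permutations with finite support. For $G\leqslant \mathrm{Sym}(X)$, $N_{\mathrm{Sym}(X)}(G):=\{\rho\in \mathrm{Sym}(X)\mid \rho^{-1}g\rho\in G \text{ for every } g\in G\}$; for $\rho\in N_{\mathrm{Sym}(X)}(G)$, $\phi_\rho$ denotes the automorphism of $G$ given by $(g)\phi_\rho:=\rho^{-1}g\rho$. For $g\in \mathrm{Sym}(X)$ and $r\in\mathbb{N}$, $\eta_r(g)$ denotes the number of orbits $\{xg^d\mid d\in\mathbb{Z}\}$ ($x\in X$) of $g$ of size exactly $r$ (so $\eta_1(g)$ is the number of fixed points of $g$), with $\eta_r(g)=\infty$ if there are infinitely many. For a group $G$ and $\phi\in\mathrm{Aut}(G)$, elements $a,b\in G$ are $\phi$-twisted conjugate if there is $x\in G$ with $(x^{-1})\phi\, a x=b$; the Reidemeister number $R(\phi)$ is the number of $\phi$-twisted conjugacy classes in $G$, with $R(\phi)=\infty$ meaning that there are infinitely many. *)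

(* Defs.v *)
From HB Require Import structures.
From mathcomp Require Import all_boot all_algebra.
From mathcomp Require Import all_classical.

Set Implicit Arguments.
Unset Strict Implicit.
Unset Printing Implicit Defensive.

Local Open Scope classical_set_scope.
Local Open Scope group_scope.

Record Sym (X : Type) := MkSym {
  sym_fun :> X -> X;
  sym_inv : X -> X;
  sym_funK : cancel sym_fun sym_inv;
  sym_invK : cancel sym_inv sym_fun
}.

Lemma sym_ext (X : Type) (g h : Sym X) : g =1 h -> g = h.
Proof.
case: g h => [g g' gK g'K] [h h' hK h'K] /= /funext eq_gh; subst h.
suff eq_gh' : g' = h' by subst h'; congr MkSym; apply: Prop_irrelevance.
by apply/funext => x; apply: (can_inj gK); rewrite g'K h'K.
Qed.

HB.instance Definition _ (X : Type) := gen_eqMixin (Sym X).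
HB.instance Definition _ (X : Type) := gen_choiceMixin (Sym X).

Section SymGroup.
Variable X : Type.
Implicit Types g h k : Sym X.

Definition sym_one : Sym X := @MkSym X id id (fun=> erefl) (fun=> erefl).
Definition sym_invg g : Sym X := MkSym (@sym_invK X g) (@sym_funK X g).
(* Permutations act on the right: [(g * h) x], that is x(gh), is (xg)h. *)
Definition sym_mul g h : Sym X :=
  @MkSym X (h \o g) (sym_inv g \o sym_inv h)
    (can_comp (@sym_funK X h) (@sym_funK X g))
    (can_comp (@sym_invK X g) (@sym_invK X h)).

Fact sym_mulA : associative sym_mul.
Proof. by move=> g h k; apply: sym_ext. Qed.
Fact sym_mul1g : left_id sym_one sym_mul.
Proof. by move=> g; apply: sym_ext. Qed.
Fact sym_mulg1 : right_id sym_one sym_mul.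
Proof. by move=> g; apply: sym_ext. Qed.
Fact sym_mulVg : left_inverse sym_one sym_invg sym_mul.
Proof. by move=> g; apply: sym_ext => x /=; rewrite sym_invK. Qed.
Fact sym_mulgV : right_inverse sym_one sym_invg sym_mul.
Proof. by move=> g; apply: sym_ext => x /=; rewrite sym_funK. Qed.

HB.instance Definition _ :=
  isGroup.Build (Sym X) sym_mulA sym_mul1g sym_mulg1 sym_mulVg sym_mulgV.
End SymGroup.

Definition support (X : Type) (g : Sym X) : set X := [set x | g x <> x].

Definition transposition (X : Type) (t : Sym X) : Prop :=
  exists x y, [/\ x <> y, t x = y, t y = x &
    forall z, z <> x -> z <> y -> t z = z].

Definition even_permutation (X : Type) (g : Sym X) : Prop :=
  exists s : seq (Sym X), [/\ forall t, t \in s -> transposition t,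
    ~~ odd (size s) & g = \prod_(t <- s) t].

Definition FAlt (X : Type) : set (Sym X) :=
  [set g | finite_set (support g) /\ even_permutation g].

Section Subgroup.
Variables (H : groupType) (G : groupClosed H).

Record subgroup_of : predArgType :=
  MkSubgroupOf { subgroup_val :> H; subgroup_valP : subgroup_val \in G }.

HB.instance Definition _ := [isSub for subgroup_val].
HB.instance Definition _ := [Choice of subgroup_of by <:].

Fact subgroup_closed : group_closed (fun g : H => g \in G).
Proof. by split; [exact: gpred1 | exact: gpredF]. Qed.

HB.instance Definition _ :=
  SubChoice_isSubGroup.Build H _ subgroup_of subgroup_closed.
End Subgroup.

(* When [G] is infinite this inclusion does not by itself imply that
   conjugation by [rho] maps [G] onto itself, so [conj_by] below is an injective
   endomorphism of [G], bijective as soon as [rho^-1] normalises [G] as well. *)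
Definition normaliser (H : groupType) (G : groupClosed H) : set H :=
  [set rho | forall g, g \in G -> g ^ rho \in G].

Section ConjBy.
Variables (H : groupType) (G : groupClosed H) (rho : H).
Hypothesis rhoN : normaliser G rho.

Definition conj_by (g : subgroup_of G) : subgroup_of G :=
  MkSubgroupOf (rhoN (subgroup_valP g)).

Fact conj_byM : {morph conj_by : g h / g * h}.
Proof. by move=> g h; apply: val_inj; rewrite /= conjMg. Qed.

HB.instance Definition _ :=
  isMultiplicative.Build (subgroup_of G) (subgroup_of G) conj_by conj_byM.
End ConjBy.

Definition zexpg (H : groupType) (g : H) (d : int) : H :=
  match d with Posz n => g ^+ n | Negz n => g ^- n.+1 end.

Definition orbit_of (X : Type) (g : Sym X) (x : X) : set X :=
  range (fun d : int => zexpg g d x).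

(* The cardinality of [orbits_of_size g r] is eta_r(g). *)
Definition orbits_of_size (X : Type) (g : Sym X) (r : nat) : set (set X) :=
  [set O | (exists x, O = orbit_of g x) /\ (O #= `I_r)%card].

Section Reidemeister.
Variables (H : groupType) (phi : {multiplicative H -> H}).

Definition twisted_conjugate (a b : H) : Prop :=
  exists x, phi (x^-1) * a * x = b.

Definition twisted_class (a : H) : set H := [set b | twisted_conjugate a b].

(* The cardinality of [twisted_classes] is the Reidemeister number R(phi). *)
Definition twisted_classes : set (set H) := range twisted_class.
End Reidemeister.

(* Main.v *)
Require Import Defs.
From HB Require Import structures.
From mathcomp Require Import all_boot all_algebra.
From mathcomp Require Import all_classical.
From mathcomp Require Import finmap.

(** Two elements [a], [b] of [G] are twisted conjugate under conjugation by
    [rho] exactly when some element of [G] conjugates [rho * a] to [rho * b]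
    (multiply the twisting relation by [rho] on the left:
    [twisted_conjugateE]).  Conjugate permutations have equally many orbits of
    each size, so the number of [r]-cycles of [rho * a] is an invariant of the
    twisted class of [a].  It therefore suffices to find elements [a] of [FAlt]
    for which this number is finite but arbitrarily large.

    Such elements are built one [r]-cycle at a time.  Let [g] have finitely
    many [r]-cycles; they cover a finite [g]-invariant set [U].  Outside [U]
    there is room for [r] new points, and [g * a] cycles them as soon as [a]
    sends the [g]-image of each to the next one.  This prescribes [a] on
    finitely many points only, so [a] can be a product of transpositions fixing
    [U] pointwise, and one further transposition of two unused points corrects
    the parity ([FAlt_extend]).  Then [g * a] keeps every [r]-cycle of [g] and
    has a new one; it still has finitely many because an orbit on which [g] and
    [g * a] differ contains one of the finitely many points that [g] sends into
    the support of [a] ([exists_FAlt_new_orbit]). *)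

Set Implicit Arguments.
Unset Strict Implicit.
Unset Printing Implicit Defensive.

Local Open Scope classical_set_scope.
Local Open Scope group_scope.

(** * Orbits of permutations *)

Section Orbits.
Variable X : Type.
Implicit Types (g h z : Sym X) (x y : X) (A : set X) (r : nat).

Lemma sym_mulE g h x : (g * h) x = h (g x).
Proof. by []. Qed.

Lemma sym_inj g : injective g.
Proof. exact: can_inj (@sym_funK X g). Qed.

Lemma symK g x : g^-1 (g x) = x.
Proof. exact: sym_funK. Qed.

Lemma symVK g x : g (g^-1 x) = x.
Proof. exact: sym_invK. Qed.

Lemma zexpgDr1 g d : zexpg g (d + 1)%R = zexpg g d * g.
Proof.
case: d => [n|[|n]] /=.
- by rewrite addn1 expgSr.
- by rewrite subnn expg1 mulVg.
- by rewrite subn1 [in RHS]expgS invgM mulgVK.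
Qed.

Lemma zexpg_conj g z d : zexpg (g ^ z) d = zexpg g d ^ z.
Proof. by case: d => n /=; rewrite ?conjVg conjXg. Qed.

Lemma orbit_refl g x : orbit_of g x x.
Proof. by exists (Posz 0). Qed.

Lemma orbit_step g x y : orbit_of g x y -> orbit_of g x (g y).
Proof. by case=> d _ <-; exists (d + 1)%R => //; rewrite zexpgDr1. Qed.

Lemma orbit_stepV g x y : orbit_of g x (g y) -> orbit_of g x y.
Proof.
case=> d _ dE; exists (d - 1)%R => //; apply: (@sym_inj g).
by rewrite -dE -sym_mulE -zexpgDr1 GRing.subrK.
Qed.

(** Invariance under [g^-1] as well as [g] is needed, since orbits run over all
    integer powers; the equivalence in the second premise provides both. *)
Lemma orbit_min g x A : A x -> (forall y, A y <-> A (g y)) ->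
  orbit_of g x `<=` A.
Proof.
move=> Ax Ag.
have AgX n y : A y <-> A ((g ^+ n) y).
  elim: n => [//|n IHn]; rewrite expgSr sym_mulE; exact: iff_trans IHn (Ag _).
move=> _ [[n|n] _ <-] /=; first exact: (iffLR (AgX n x) Ax).
by apply: (iffRL (AgX n.+1 _)); rewrite symVK.
Qed.

Lemma orbit_eq g x y : orbit_of g x y -> orbit_of g x = orbit_of g y.
Proof.
move=> gxy.
have stepE u v : orbit_of g u v <-> orbit_of g u (g v).
  by split; [exact: orbit_step|exact: orbit_stepV].
have gyx : orbit_of g y x.
  (* Otherwise the complement of the orbit of [y] is a [g]-invariant set
     containing [x], hence also [y]. *)
  apply: contrapT => ngyx; suff : (~` orbit_of g y) y by apply; exact: orbit_refl.
  by apply: orbit_min gxy => // u; split; apply: contra_not; apply stepE.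
by apply/seteqP; split; apply: orbit_min.
Qed.

(** Agreement on the orbit of [g] alone is enough: [g] permutes that orbit, so
    [h] does too and, being injective, maps no outside point into it. *)
Lemma orbit_eq_on g h x : (forall y, orbit_of g x y -> h y = g y) ->
  orbit_of h x = orbit_of g x.
Proof.
move=> hg; apply/seteqP.
have back y : orbit_of g x (h y) -> orbit_of g x y.
  move=> ghy.
  have gV : orbit_of g x (g^-1 (h y)) by apply: orbit_stepV; rewrite symVK.
  by have /sym_inj <- : h (g^-1 (h y)) = h y by rewrite hg ?symVK.
split.
  apply: orbit_min => [|y]; first exact: orbit_refl.
  by split=> [gy|/back//]; rewrite hg //; apply: orbit_step.
move=> y gy; suff [] : (orbit_of g x `&` orbit_of h x) y by [].
apply: orbit_min gy => [|{}y]; first by split; apply: orbit_refl.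
split=> [[gy hy]|[gy hy]].
  by split; [|rewrite -hg //]; apply: orbit_step.
have {}gy := orbit_stepV gy.
by split=> //; apply: orbit_stepV; rewrite hg.
Qed.

Lemma orbit_cycle r (y : nat -> X) g : (0 < r)%N ->
  (forall i, (i < r)%N -> g (y i) = y (i.+1 %% r)%N) ->
  orbit_of g (y 0%N) = y @` `I_r.
Proof.
move=> r_gt0 gy; apply/seteqP; split.
  apply: orbit_min => [|z]; first by exists 0%N.
  split=> [[i /= ir <-]|[i /= ir iE]].
    by rewrite gy //; exists (i.+1 %% r)%N => //=; rewrite ltn_mod.
  case: i => [|i] in ir iE *.
    exists r.-1; rewrite /= ?prednK //; apply: (@sym_inj g).
    by rewrite gy ?prednK // modnn.
  exists i; first exact: ltnW.
  by apply: (@sym_inj g); rewrite gy ?modn_small // ltnW.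
move=> _ [i /= ir <-]; elim: i ir => [|i IHi] ir; first exact: orbit_refl.
by have /IHi/orbit_step := ltnW ir; rewrite gy ?modn_small // ltnW.
Qed.

Lemma orbit_conj g z x : orbit_of (g ^ z) (z x) = z @` orbit_of g x.
Proof.
have E d : zexpg (g ^ z) d (z x) = z (zexpg g d x).
  by rewrite zexpg_conj conjgE !sym_mulE symK.
apply/seteqP; split=> y.
  by case=> d _ <-; exists (zexpg g d x); [exists d|rewrite E].
by case=> _ [d _ <-] <-; exists d.
Qed.

Lemma orbits_conj_sub g z r :
  (fun O : set X => z @` O) @` orbits_of_size g r `<=`
  orbits_of_size (g ^ z) r.
Proof.
move=> _ [O [[x ->] Or] <-]; split; first by exists (z x); rewrite orbit_conj.
by apply: card_eq_trans Or; apply: inj_card_eq => u v _ _; apply: sym_inj.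
Qed.

Lemma orbits_conj g z r :
  orbits_of_size (g ^ z) r = (fun O : set X => z @` O) @` orbits_of_size g r.
Proof.
apply/seteqP; split; last exact: orbits_conj_sub.
move=> O gzO; exists (z^-1%g @` O).
  by have := @orbits_conj_sub (g ^ z) z^-1%g r; rewrite conjgK; apply; exists O.
rewrite image_comp -[RHS]image_id; congr (_ @` _).
by apply/funext => x /=; rewrite symVK.
Qed.

Lemma card_orbits_conj g z r :
  (orbits_of_size (g ^ z) r #= orbits_of_size g r)%card.
Proof.
rewrite orbits_conj; apply: inj_card_eq => A B _ _ /seteqP[AB BA].
apply/seteqP; split=> x; [move: AB|move: BA] => /(_ (z x)) sub Ax.
- by have [|y By /sym_inj <-] := sub; first by exists x.
- by have [|y By /sym_inj <-] := sub; first by exists x.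
Qed.

End Orbits.

(** * Realising finite partial injections by even permutations *)

Section Extension.
Variable X : Type.
Implicit Types (g h t : Sym X) (x y z : X) (A B : set X) (s : seq (Sym X)).

Section Swap.
Variables x y : X.

Definition swap_fun z :=
  if pselect (z = x) then y else if pselect (z = y) then x else z.

Lemma swap_funK : involutive swap_fun.
Proof.
by move=> z; rewrite /swap_fun; do ![case: pselect => //=; try congruence].
Qed.

Definition swap : Sym X := MkSym swap_funK swap_funK.

Lemma swapL : swap x = y.
Proof. by rewrite /= /swap_fun; case: pselect. Qed.

Lemma swapD z : z <> x -> z <> y -> swap z = z.
Proof. by rewrite /= /swap_fun => ? ?; do 2 case: pselect. Qed.

Lemma swap_transposition : x <> y -> transposition swap.
Proof.
move=> xy; exists x, y; split=> //; last exact: swapD.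
  exact: swapL.
by rewrite /= /swap_fun; do 2 case: pselect => //=; congruence.
Qed.

End Swap.

Lemma prod_rcons s t : \prod_(u <- rcons s t) u = (\prod_(u <- s) u) * t.
Proof. by rewrite big_rcons. Qed.

Lemma support_prod s : (forall t, t \in s -> transposition t) ->
  finite_set (Defs.support (\prod_(t <- s) t)).
Proof.
elim: s => [|t s IHs] ts.
  rewrite big_nil; apply: sub_finite_set (finite_set0 X) => x /=; exact.
have /IHs fs : forall u, u \in s -> transposition u.
  by move=> u us; apply: ts; rewrite inE us orbT.
have [x [y [xy _ _ txy]]] := ts t (mem_head _ _).
rewrite big_cons.
apply: (@sub_finite_set _ _ ([set x; y] `|` Defs.support (\prod_(u <- s) u))).
  move=> z zts; apply: contrapT => /not_orP[/= /not_orP[zx zy] zs].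
  by apply: zts; rewrite sym_mulE txy //; apply: contrapT.
by rewrite finite_setU; split=> //; apply: finite_set2.
Qed.

(** Any finite partial injection [p i |-> q i] extends to a finitary
    permutation: once the first values are right, post-composing with the
    transposition of the current and the desired value of [p k] corrects the
    next one without disturbing them, by injectivity of [p] and [q].  Keeping
    [p] and [q] away from [B] keeps all the transpositions away from [B]. *)
Lemma transpositions_extend k (p q : nat -> X) B :
  {in gtn k &, injective p} -> {in gtn k &, injective q} ->
  (forall i, (i < k)%N -> ~ B (p i)) -> (forall i, (i < k)%N -> ~ B (q i)) ->
  exists s, [/\ forall t, t \in s -> transposition t,
    forall x, B x -> (\prod_(t <- s) t) x = x &
    forall i, (i < k)%N -> (\prod_(t <- s) t) (p i) = q i].
Proof.
elim: k => [|k IHk] pI qI pB qB.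
  by exists [::]; split=> // x Bx; rewrite big_nil.
have lt_kS i : i \in gtn k -> i \in gtn k.+1 by rewrite !inE; exact: ltnW.
have [||||s [ts sB sp]] := IHk.
- by move=> i j /lt_kS ik /lt_kS jk; apply: pI.
- by move=> i j /lt_kS ik /lt_kS jk; apply: qI.
- by move=> i /ltnW; apply: pB.
- by move=> i /ltnW; apply: qB.
set a := \prod_(t <- s) t in sB sp.
have [apk|apk] := pselect (a (p k) = q k).
  exists s; split=> // i; rewrite ltnS leq_eqVlt => /orP[/eqP->//|]; exact: sp.
exists (rcons s (swap (a (p k)) (q k))); rewrite prod_rcons -/a.
split.
- move=> t; rewrite mem_rcons inE => /orP[/eqP->|/ts//].
  exact: swap_transposition.
- move=> x Bx; rewrite sym_mulE (sB x Bx) // swapD // => xE.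
    have xpk : x = p k by apply: (@sym_inj _ a); rewrite (sB x Bx).
    by apply: (pB k) => //; rewrite -xpk.
  by apply: (qB k) => //; rewrite -xE.
- move=> i; rewrite ltnS leq_eqVlt sym_mulE => /orP[/eqP->|ik].
    exact: swapL.
  have iS : i \in gtn k.+1 by apply: lt_kS.
  have kS : k \in gtn k.+1 by rewrite inE.
  have neq_ik : i <> k by move=> ik'; rewrite ik' ltnn in ik.
  rewrite (sp i ik) swapD // => qE; apply: neq_ik.
    by apply: pI => //; apply: (@sym_inj _ a); rewrite (sp i ik).
  exact: qI.
Qed.

(** The points [u] and [v] serve to fix the parity: exchanging them after an odd
    extension makes it even and affects none of the prescribed values. *)
Lemma FAlt_extend k (p q : nat -> X) B u v :
  {in gtn k &, injective p} -> {in gtn k &, injective q} ->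
  (forall i, (i < k)%N -> ~ B (p i)) -> (forall i, (i < k)%N -> ~ B (q i)) ->
  u <> v -> ~ B u -> ~ B v ->
  (forall i, (i < k)%N -> q i <> u) -> (forall i, (i < k)%N -> q i <> v) ->
  exists a, [/\ FAlt a, forall x, B x -> a x = x &
    forall i, (i < k)%N -> a (p i) = q i].
Proof.
move=> pI qI pB qB uv uB vB qu qv.
have [s [ts sB sp]] := transpositions_extend pI qI pB qB.
have [odd_s|even_s] := boolP (odd (size s)); last first.
  exists (\prod_(t <- s) t); split=> //.
  by split; [exact: support_prod|exists s].
pose s' := rcons s (swap u v).
have ts' t : t \in s' -> transposition t.
  rewrite mem_rcons inE => /orP[/eqP->|/ts//]; exact: swap_transposition.
exists (\prod_(t <- s') t); split.
- split; first exact: support_prod.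
  by exists s'; split; rewrite // size_rcons /= odd_s.
- move=> x Bx; rewrite prod_rcons sym_mulE (sB x Bx) swapD //.
    by move=> xu; apply: uB; rewrite -xu.
  by move=> xv; apply: vB; rewrite -xv.
- move=> i ik; rewrite prod_rcons sym_mulE sp // swapD //; auto.
Qed.

End Extension.

(** * Creating new cycles *)

Section NewCycle.
Variables (X : Type) (r : nat).
Hypotheses (infX : infinite_set [set: X]) (r_gt0 : (0 < r)%N).
Implicit Types g a : Sym X.

(** An orbit of [g * a] is either an orbit of [g] or contains a point of the
    finite set [D] where [g * a] and [g] differ. *)
Lemma finite_orbits_mulr g a : finite_set (Defs.support a) ->
  finite_set (orbits_of_size g r) -> finite_set (orbits_of_size (g * a) r).
Proof.
move=> fa fg; pose D := g @^-1` Defs.support a.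
apply: (@sub_finite_set _ _
  (orbits_of_size g r `|` orbit_of (g * a) @` D)); last first.
  rewrite finite_setU; split=> //; apply: finite_image.
  by apply: finite_preimage fa => x y _ _; apply: sym_inj.
move=> _ [[x ->] Or].
have [[y [gay Dy]]|noD] := pselect (exists y, orbit_of (g * a) x y /\ D y).
  by right; exists y => //; rewrite (orbit_eq gay).
have E : orbit_of g x = orbit_of (g * a) x.
  apply: orbit_eq_on => y gay; rewrite sym_mulE; apply: contrapT => /nesym Dy.
  by apply: noD; exists y.
by left; rewrite -E in Or *; split=> //; exists x.
Qed.

(** The old orbits are kept and not only outnumbered: with both sets finite,
    the proper inclusion makes the count strictly increase under iteration. *)
Lemma exists_FAlt_new_orbit g : finite_set (orbits_of_size g r) ->
  exists a, [/\ FAlt a, finite_set (orbits_of_size (g * a) r) &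
    orbits_of_size g r `<` orbits_of_size (g * a) r].
Proof.
move=> fg; pose U := \bigcup_(O in orbits_of_size g r) O.
have fU : finite_set U.
  by apply: bigcup_finite => // O [_ Or]; apply/finite_setP; exists r.
have gU x : U x <-> U (g x).
  split=> -[_ [[z ->] Or] zx]; exists (orbit_of g z); do ?split=> //;
    by [exists z|exact: orbit_step|exact: orbit_stepV].
have /infiniteP/card_leP[f] : infinite_set (~` U).
  by rewrite -setTD; apply: infinite_setD.
have [y yI yU] : exists2 y : nat -> X, injective y & forall i, ~ U (y i).
  exists (fun i => val (f (SigSub (mem_set (I : [set: nat] i))))) => [i j|i].
    by move=> /val_inj/(@inj _ _ _ f) => /(_ (in_setT _) (in_setT _)) [].
  by have := set_valP (f (SigSub (mem_set (I : [set: nat] i)))).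
have lt_mod i : (i %% r < r)%N by rewrite ltn_mod.
(* [g * a] maps [y i] to [a (g (y i))], so [a] must send [g (y i)] to the
   successor of [y i] in the intended cycle; [y r] and [y r.+1] are unused. *)
have [|||||||||a [aA aU ay]] := @FAlt_extend X r (fun i => g (y i))
    (fun i => y (i.+1 %% r)%N) U (y r) (y r.+1).
- by move=> i j _ _ yE; apply: yI; apply: (@sym_inj _ g).
- move=> i j; rewrite !inE => ir jr yE; have /eqP := yI _ _ yE.
  by rewrite -(addn1 i) -(addn1 j) eqn_modDr !modn_small // => /eqP.
- by move=> i _ Ugy; apply: (yU i); apply/gU.
- by move=> i _; apply: yU.
- by move=> /yI/eqP; rewrite ltn_eqF.
- exact: yU.
- exact: yU.
- by move=> i _ /yI ir; have := lt_mod i.+1; rewrite ir ltnn.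
- by move=> i _ /yI ir; have := lt_mod i.+1; rewrite ir ltnNge leqnSn.
exists a; split=> //; first by apply: finite_orbits_mulr; case: aA.
have Oy : orbit_of (g * a) (y 0%N) = y @` `I_r by exact: orbit_cycle.
split=> [_ [[x ->] Or]|/(_ (y @` `I_r))].
  have E : orbit_of (g * a) x = orbit_of g x.
    apply: orbit_eq_on => z gxz; rewrite sym_mulE aU //.
    by apply: (iffLR (gU z)); exists (orbit_of g x) => //; split=> //; exists x.
  by split; rewrite -?E //; [exists x|rewrite E].
have nOy : ~ orbits_of_size g r (y @` `I_r).
  by move=> Oyg; apply: (yU 0%N); exists (y @` `I_r) => //; exists 0%N.
apply: contra_not nOy; apply; split; first by exists (y 0%N).
by apply: inj_card_eq => i j _ _; apply: yI.
Qed.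

End NewCycle.

(** * Counting twisted conjugacy classes *)

(** Since [rho^-1 * z^-1 * rho * a * z = rho^-1 * (rho * a) ^ z], left
    multiplication by [rho] turns twisted conjugacy in [G] into ordinary
    conjugacy by [G] inside the coset [rho * G]. *)
Lemma twisted_conjugateE (H : groupType) (G : groupClosed H) (rho : H)
  (rhoN : normaliser G rho) (a b : subgroup_of G) :
  twisted_conjugate (conj_by rhoN) a b <->
  exists z : subgroup_of G, (rho * val a) ^ val z = rho * val b.
Proof.
have E (z : subgroup_of G) : val (conj_by rhoN z^-1 * a * z) =
    rho^-1 * (rho * val a) ^ val z.
  by rewrite /= !conjgE !mulgA.
split=> [[z zab]|[z zab]]; exists z.
  by rewrite -zab E mulVKg.
by apply: val_inj; rewrite E zab mulKg.
Qed.

Lemma finite_set_nat_bounded (K : set nat) : finite_set K ->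
  exists M, forall k, K k -> (k <= M)%N.
Proof.
move=> fK; exists (\max_(k <- enum_fset (fset_set K)) k) => k Kk.
by apply: leq_bigmax_seq => //; rewrite in_fset_set //; exact: mem_set.
Qed.

Theorem proposition3p4 (X : Type) (hX : infinite_set [set: X])
  (G : groupClosed (Sym X)) (hG : forall g : Sym X, FAlt g -> g \in G)
  (rho : Sym X) (hrho : normaliser G rho)
  (heta : exists r : nat, (0 < r)%N /\ finite_set (orbits_of_size rho r)) :
  infinite_set (twisted_classes (conj_by hrho)).
Proof.
case: heta => r [r_gt0 frho] fin.
pose cls := twisted_class (conj_by hrho).
pose O (a : subgroup_of G) := orbits_of_size (rho * val a) r.
pose S := [set a | finite_set (O a)].
(* [fset_set] is empty on infinite sets, so [eta] counts orbits only for [a]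
   in [S]. *)
pose eta a := size (fset_set (O a)).
have eta_inv a b : S a -> twisted_conjugate (conj_by hrho) a b -> eta a = eta b.
  move=> /finite_setP[n an] /twisted_conjugateE[z zab].
  have bn : (O b #= `I_n)%card.
    by rewrite /O -zab; apply: card_eq_trans an; apply: card_orbits_conj.
  by rewrite /eta (card_fset_set an) (card_fset_set bn).
(* [eta] factors through the classes on [S], so finitely many classes bound
   it. *)
pose rep (C : set (subgroup_of G)) := xget 1 C.
have eta_rep a : S a -> eta a = eta (rep (cls a)).
  move=> Sa; apply: (eta_inv _ _ Sa); rewrite /rep; apply: (@xgetI _ 1 (cls a) a).
  by apply/twisted_conjugateE; exists 1; rewrite conjg1.
have [M etaM] : exists M, forall k, (eta @` S) k -> (k <= M)%N.
  apply: finite_set_nat_bounded.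
  apply: (@sub_finite_set _ _ ((eta \o rep) @` twisted_classes (conj_by hrho))).
    by move=> _ [a Sa <-]; exists (cls a); [exists a|rewrite /= -eta_rep].
  exact: finite_image.
have unbounded n : exists2 a, S a & (n <= eta a)%N.
  elim: n => [|n [a Sa na]].
    by exists 1 => //; rewrite /S /O /= mulg1.
  have [b [bA fb ab]] := exists_FAlt_new_orbit hX r_gt0 Sa.
  pose b' : subgroup_of G := MkSubgroupOf (hG _ bA).
  have Oab : O (a * b') = orbits_of_size (rho * val a * b) r.
    by rewrite /O /= mulgA.
  exists (a * b'); first by rewrite /S /= Oab.
  apply: leq_ltn_trans na _; rewrite /eta Oab; apply: fproper_ltn_card.
  case: ab => ab ba; rewrite fproperE; apply/andP; split.
    by rewrite -fset_set_sub.
  by apply/negP; rewrite -fset_set_sub.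
have [a Sa] := unbounded M.+1.
by rewrite ltnNge etaM //; exists a.
Qed.
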